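(* Let $Q$ be an abelian group of order $q$, let $\Gamma=H(n,q)$ with vertex set the group $Q^n$, and let $C$ be an additive completely regular code in $\Gamma$ with minimum distance $\delta(C)\ge2$. Suppose the quotient graph $\Gamma/\Delta(C)$ is isomorphic to the Hamming graph $H(m,q')$. Then $m$ divides $n$ and, up to a permutation of the coordinate positions, $C=\prod_{i=1}^m C^{(i)}$, where each $C^{(i)}$ is a $q$-ary completely regular code of length $n/m$ with covering radius $1$.
   Context: $H(n,q)$ has vertex set $Q^n$, two words adjacent iff they differ in exactly one coordinate. An additive code is a subgroup $C\le Q^n$; $\Delta(C)=\{C+x:x\in Q^n\}$ is its coset partition, and $\Gamma/\Delta(C)$ is the graph on the cosets, two distinct cosets adjacent iff some edge of $\Gamma$ joins them. $\delta(C)$ is the minimum Hamming distance between distinct codewords. For a code $C$, $C_i$ is the set of vertices at distance $i$ from $C$ and the covering radius $\rho$ is the largest $i$ with $C_i\neq\emptyset$; $C$ is completely regular if $\{C_0,\dots,C_\rho\}$ is an equitable partition (the number of neighbours in $C_j$ of a vertex of $C_i$ depends only on $i,j$). A $q$-ary code of length $\ell$ is a code in $H(\ell,q)$, and $\prod_i C^{(i)}$ denotes the cartesian product of codes, concatenating coordinates. *)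

(* Defs.v *)
From mathcomp Require Import all_boot all_algebra.

Set Implicit Arguments.
Unset Strict Implicit.
Unset Printing Implicit Defensive.

Import GRing.Theory.

Section Hamming.
Variables (n : nat) (T : finType).
Implicit Types (x y : {ffun 'I_n -> T}) (C : {set {ffun 'I_n -> T}}).

Definition hdist x y : nat := #|[set i | x i != y i]|.

Definition hamming_adj : rel {ffun 'I_n -> T} := [rel x y | hdist x y == 1].

(* The default n + 1 exceeds every Hamming distance in length n; it is the    *)
(* value taken on codes with at most one word.                                *)
Definition min_distance C : nat :=
  \big[minn/n.+1]_(p : {ffun 'I_n -> T} * {ffun 'I_n -> T} |
      [&& p.1 \in C, p.2 \in C & p.1 != p.2]) hdist p.1 p.2.

(* The set C_i of vertices at distance i from C; all C_i are empty if C is.   *)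
Definition dist_cell C (i : nat) : {set {ffun 'I_n -> T}} :=
  [set x | [exists c in C, hdist x c == i] && [forall c in C, i <= hdist x c]].

(* The range i <= n suffices because Hamming distances never exceed n.        *)
Definition covering_radius C : nat :=
  \max_(i < n.+1 | dist_cell C i != set0) i.

Definition distance_partition C : {set {set {ffun 'I_n -> T}}} :=
  [set dist_cell C i | i : 'I_(covering_radius C).+1].

End Hamming.

Definition equitable (V : finType) (e : rel V) (P : {set {set V}}) : Prop :=
  partition P [set: V] /\
  {in P &, forall A B : {set V},
    {in A &, forall x y, #|[set z in B | e x z]| = #|[set z in B | e y z]|}}.

Definition completely_regular n (T : finType) (C : {set {ffun 'I_n -> T}}) :=
  equitable (@hamming_adj n T) (distance_partition C).

Definition additive_code n (Q : finZmodType) (C : {set {ffun 'I_n -> Q}}) :=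
  zmod_closed (mem C).

Definition coset_partition n (Q : finZmodType) (C : {set {ffun 'I_n -> Q}}) :
    {set {set {ffun 'I_n -> Q}}} :=
  [set [set (c + x)%R | c : {ffun 'I_n -> Q} in C] | x : {ffun 'I_n -> Q}].

Definition quotient_adj (V : finType) (e : rel V) : rel {set V} :=
  [rel A B : {set V} | (A != B) && [exists x in A, exists y in B, e x y]].

Definition graph_iso (S T : finType) (U : {set S}) (eU : rel S)
    (W : {set T}) (eW : rel T) : Prop :=
  exists f : S -> T, [/\ {in U &, injective f}, f @: U = W
    & {in U &, forall x y, eU x y = eW (f x) (f y)}].

Lemma block_index_subproof m l (i : 'I_m) (j : 'I_l) : i * l + j < m * l.
Proof.
apply: (@leq_trans (i.+1 * l)); first by rewrite mulSn addnC ltn_add2r.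
by rewrite leq_mul2r ltn_ord orbT.
Qed.

Definition block_index m l (i : 'I_m) (j : 'I_l) : 'I_(m * l) :=
  Ordinal (block_index_subproof i j).

Definition prod_code m l (T : finType) (D : 'I_m -> {set {ffun 'I_l -> T}}) :
    {set {ffun 'I_(m * l) -> T}} :=
  [set x : {ffun 'I_(m * l) -> T} |
    [forall i, [ffun j => x (block_index i j)] \in D i]].

(* Equality up to a permutation of the coordinate positions.  A bijection of  *)
(* the index types forces n = k; keeping n and k as separate variables avoids *)
(* a cast between, e.g., n and m * (n %/ m).                                  *)
Definition equal_up_to_coords n k (T : finType)
    (C : {set {ffun 'I_n -> T}}) (D : {set {ffun 'I_k -> T}}) : Prop :=
  exists2 s : 'I_n -> 'I_k, bijective s
    & C = [set [ffun i => y (s i)] | y : {ffun 'I_k -> T} in D].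

(* Main.v *)
(* Write g x for the vertex of H(m, q') given to the coset C + x.  For each   *)
(* direction k, the words x such that g x and g 0 agree off the coordinate k  *)
(* form a subgroup of Q^n, since their cosets form a maximal clique of the    *)
(* quotient.  The multiples a e_i of a unit vector have distinct cosets,      *)
(* which form a clique of size q >= 2, so they lie in exactly one of these m  *)
(* subgroups; this splits the coordinates into m blocks.  The quotient is the *)
(* sum of the m subgroups modulo C, each of order q', and has order q'^m, so  *)
(* the sum is direct and C is the product of its parts in the blocks.  Each   *)
(* vertex at distance 1 from C has the same number c of neighbours in C, so a *)
(* block of size l satisfies l (q - 1) = c (q' - 1): the blocks have the same *)
(* size, and c is the remaining parameter of each factor.                     *)

Require Import Defs.
From mathcomp Require Import all_boot all_algebra.

Set Implicit Arguments.
Unset Strict Implicit.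
Unset Printing Implicit Defensive.

Import GRing.Theory.

(** The isomorphism is lifted to a map [g] on words whose fibres are the cosets of [C]; images are
    equal or adjacent exactly when the words differ by a single-coordinate word modulo [C]. Since a
    clique with two vertices stays in one line ([agree_off_clique]), [coset_line k] is a subgroup
    ([coset_lineB]) and each coordinate belongs to one direction ([single_coset_line]). Counting
    shows that [C] is the product of its parts in the blocks ([block_projP]) and that the blocks
    have equal size ([card_block]). Each factor inherits from [C] the number of codeword neighbours,
    which makes it completely regular with covering radius 1 ([block_code_regular]). *)

Section HammingDistance.
Variables (n : nat) (T : finType).
Implicit Types (u v w : {ffun 'I_n -> T}) (k : 'I_n).

(** * Hamming distance and the lines of a Hamming graph *)

Lemma hdistC u v : hdist u v = hdist v u.
Proof. by apply: eq_card => i; rewrite !inE eq_sym. Qed.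

Lemma hdist_eq0 u v : (hdist u v == 0) = (u == v).
Proof.
rewrite cards_eq0; apply/eqP/eqP => [h|->]; last first.
  by apply/setP => i; rewrite !inE eqxx.
by apply/ffunP => i; move/setP/(_ i): h; rewrite !inE => /negbFE/eqP.
Qed.

Lemma hdist_le u v : hdist u v <= n.
Proof. by rewrite -[leqRHS]card_ord max_card. Qed.

Lemma min_distance_le (C : {set {ffun 'I_n -> T}}) u v :
  u \in C -> v \in C -> u != v -> min_distance C <= hdist u v.
Proof.
move=> uC vC uv; rewrite /min_distance.
have: (u, v) \in index_enum ({ffun 'I_n -> T} * {ffun 'I_n -> T})%type.
  exact: mem_index_enum.
elim: index_enum => // p s IHs; rewrite inE big_cons => /predU1P[<-|/IHs le_s].
  by rewrite /= uC vC uv geq_minl.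
by case: ifP => // _; rewrite geq_min le_s orbT.
Qed.

(** The relation of lying on a common line in direction [k]; these lines are the maximal cliques of
    the Hamming graph. *)
Definition agree_off k u v := [forall j, (j != k) ==> (u j == v j)].

Lemma agree_offP k u v :
  reflect (forall j, j != k -> u j = v j) (agree_off k u v).
Proof.
apply: (iffP forallP) => h j; last by apply/implyP => /h ->.
by move=> jk; apply/eqP/(implyP (h j)).
Qed.

Lemma agree_off_refl k u : agree_off k u u.
Proof. exact/agree_offP. Qed.

Lemma agree_off_sym k u v : agree_off k u v = agree_off k v u.
Proof. by apply/agree_offP/agree_offP => h j /h. Qed.

Lemma agree_off_trans k u v w :
  agree_off k u v -> agree_off k v w -> agree_off k u w.
Proof.
move=> /agree_offP uv /agree_offP vw; apply/agree_offP => j jk.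
by rewrite uv ?vw.
Qed.

Lemma agree_off_eq k u v : agree_off k u v -> u k = v k -> u = v.
Proof.
by move=> /agree_offP uv uvk; apply/ffunP => j; have [->|/uv] := eqVneq j k.
Qed.

Lemma agree_off_inj k k' u v :
  agree_off k u v -> agree_off k' u v -> u != v -> k = k'.
Proof.
move=> uv /agree_offP uv'; apply: contraNeq => kk'; apply/eqP.
by apply: (agree_off_eq uv); apply: uv'.
Qed.

Lemma hdist_le1 k u v : agree_off k u v -> hdist u v <= 1.
Proof.
move=> /agree_offP uv; rewrite -(cards1 k); apply: subset_leq_card.
by apply/subsetP => j; rewrite !inE; apply: contraNT => /uv ->.
Qed.

Lemma hdist_le1_agree u v : 0 < n -> hdist u v <= 1 -> exists k, agree_off k u v.
Proof.
move=> n_gt0; rewrite leq_eqVlt ltnS leqn0 hdist_eq0.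
case/orP => [/cards1P[k uv]|/eqP->]; last first.
  by exists (Ordinal n_gt0); apply: agree_off_refl.
exists k; apply/agree_offP => j jk; apply/eqP/negbFE.
by move/setP/(_ j): uv; rewrite !inE (negbTE jk).
Qed.

(* A clique of a Hamming graph with at least two vertices lies in one line. *)
Lemma agree_off_clique k u v w :
  agree_off k u v -> u != v -> hdist u w <= 1 -> hdist v w <= 1 ->
  agree_off k u w.
Proof.
move=> /[dup] uv /agree_offP uvE neq_uv uw vw.
have uvk : u k != v k by apply: contraNneq neq_uv => /(agree_off_eq uv)->.
apply/agree_offP => j jk; apply/eqP; apply/negPn/negP => uwj.
have vwj : v j != w j by rewrite -uvE.
have one_diff (x y : {ffun 'I_n -> T}) a b :
    hdist x y <= 1 -> x a != y a -> x b != y b -> a = b.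
  move=> /card_le1_eqP xy xya xyb; apply/esym/xy; by rewrite inE.
(* As [u k] and [v k] differ, [w k] misses one of them; that word then differs from [w] at both [j]
   and [k]. *)
have [uwk|uwk] := eqVneq (u k) (w k).
  by move: jk; rewrite (one_diff v w j k) ?eqxx // -uwk eq_sym.
by move: jk; rewrite (one_diff u w j k) ?eqxx.
Qed.

End HammingDistance.

(** * Words supported on one coordinate *)

Section SingleCoordinate.
Variables (n : nat) (Q : finZmodType).
Implicit Types (x y : {ffun 'I_n -> Q}) (i : 'I_n) (a : Q).
Local Open Scope ring_scope.

Definition single i a : {ffun 'I_n -> Q} := [ffun j => if j == i then a else 0].

Lemma single0 i : single i 0 = 0.
Proof. by apply/ffunP => j; rewrite !ffunE if_same. Qed.

Lemma singleN i a : single i (- a) = - single i a.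
Proof. by apply/ffunP => j; rewrite !ffunE; case: eqP => _; rewrite ?oppr0. Qed.

Lemma singleD i a b : single i (a + b) = single i a + single i b.
Proof. by apply/ffunP => j; rewrite !ffunE; case: eqP => _; rewrite ?addr0. Qed.

Lemma single_inj i j a b : a != 0 -> single i a = single j b -> i = j /\ a = b.
Proof.
move=> a0 /ffunP/(_ i); rewrite !ffunE eqxx; case: eqP => [->|_] // ab.
by rewrite ab eqxx in a0.
Qed.

Lemma sum_single (P : pred 'I_n) x :
  \sum_(i | P i) single i (x i) = [ffun i => if P i then x i else 0].
Proof.
apply/ffunP => j; rewrite sum_ffunE ffunE.
under eq_bigr => i _ do rewrite ffunE eq_sym.
by rewrite -big_mkcondr big_mkcondl big_pred1_eq.
Qed.

(** Turns adjacency into group arithmetic: the Hamming graph is the Cayley graph of [Q^n] on the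
    nonzero single-coordinate words. *)
Lemma hdist1P x y :
  reflect (exists i a, a != 0 /\ x - y = single i a) (hdist x y == 1%N).
Proof.
apply: (iffP cards1P) => [[i xy]|[i [a [a0 xy]]]].
  exists i, (x i - y i); split.
    by move/setP/(_ i): xy; rewrite !inE eqxx subr_eq0.
  apply/ffunP => j; rewrite !ffunE; move/setP/(_ j): xy; rewrite !inE.
  by have [->|_] := eqVneq j i => // /negbFE/eqP->; rewrite subrr.
exists i; apply/setP => j; rewrite !inE -subr_eq0.
move/ffunP/(_ j): xy; rewrite !ffunE => ->.
by case: (j == i); rewrite ?eqxx.
Qed.

Lemma card_hdist1 x :
  #|[set z | hdist x z == 1%N]| = #|[set z : {ffun 'I_n -> Q} | hdist 0 z == 1%N]|.
Proof.
rewrite -(card_imset [set z | hdist 0 z == 1%N] (addrI x)).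
apply: eq_card => z; rewrite inE; apply/idP/imsetP => [|[w]].
  case/hdist1P => i [a [a0 xz]]; exists (z - x); last by rewrite addrC subrK.
  by rewrite inE; apply/hdist1P; exists i, a; rewrite sub0r opprB.
rewrite inE => /hdist1P[i [a [a0 w_a]]] ->; apply/hdist1P; exists i, a.
by rewrite opprD addrA subrr.
Qed.

End SingleCoordinate.

Lemma dist_cell_in_partition n (T : finType) (C : {set {ffun 'I_n -> T}}) i :
  dist_cell C i != set0 -> dist_cell C i \in distance_partition C.
Proof.
move=> Ci; have /set0Pn[x] := Ci; rewrite inE => /andP[/exists_inP[z _ /eqP xz] _].
have le_in : i < n.+1 by rewrite ltnS -xz hdist_le.
have le_ir : i < (covering_radius C).+1.
  rewrite ltnS.
  exact: (@leq_bigmax_cond _ _ (fun j : 'I_n.+1 => j : nat) (Ordinal le_in)).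
by apply/imsetP; exists (Ordinal le_ir).
Qed.

(** * Independent sets with a constant number [c] of neighbours from outside *)

Section RadiusOne.
Variables (n c : nat) (Q : finZmodType) (D : {set {ffun 'I_n -> Q}}).
Hypotheses (D_proper : D \proper setT)
  (D_dist : {in D &, forall x y, hdist x y != 1})
  (D_nbr : forall x, x \notin D -> exists2 z, z \in D & hdist x z = 1)
  (D_card : forall x, x \notin D -> #|[set z in D | hdist x z == 1]| = c).

Lemma dist_cell0 : dist_cell D 0 = D.
Proof.
apply/setP => x; rewrite inE; apply/andP/idP => [[/exists_inP[z zD]]|xD].
  by rewrite hdist_eq0 => /eqP->.
by split; [apply/exists_inP; exists x; rewrite // hdist_eq0 | apply/forall_inP].
Qed.

Lemma dist_cell1 : dist_cell D 1 = ~: D.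
Proof.
apply/setP => x; rewrite !inE; apply/andP/idP => [[_ /forall_inP h]|/[dup] xD].
  by apply/negP => /h; rewrite lt0n hdist_eq0 eqxx.
move=> /D_nbr[z zD xz]; split; first by apply/exists_inP; exists z => //; apply/eqP.
apply/forall_inP => y yD; rewrite lt0n hdist_eq0; apply: contraNneq xD => ->.
exact: yD.
Qed.

Lemma covering_radius1 : covering_radius D = 1.
Proof.
have [_ [x _ xD]] := properP D_proper.
have [z zD xz] := D_nbr xD.
(* The maximum in [covering_radius] runs over [i < n.+1], so index 1 is in range only if [0 < n]. *)
have n_gt0 : 0 < n by rewrite -xz hdist_le.
apply/eqP; rewrite eqn_leq; apply/andP; split.
  apply/bigmax_leqP => i /set0Pn[y]; rewrite inE => /andP[_ /forall_inP h].
  have [/h|/D_nbr[t /h le_t yt]] := boolP (y \in D); last by rewrite -yt.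
  by move/leq_trans; apply; rewrite leqW // leqn0 hdist_eq0.
apply: (@leq_bigmax_cond _ _ (fun i : 'I_n.+1 => i : nat)
  (Ordinal (n_gt0 : 1 < n.+1))).
by rewrite /= dist_cell1; apply/set0Pn; exists x; rewrite inE.
Qed.

Lemma distance_partition1 : distance_partition D = [set D; ~: D].
Proof.
rewrite /distance_partition covering_radius1.
apply/setP => A; rewrite !inE; apply/imsetP/orP => [[[[|[|//]] ?] _ ->]|[]/eqP->].
- by rewrite dist_cell0 eqxx; left.
- by rewrite dist_cell1 eqxx; right.
- by exists ord0; rewrite // dist_cell0.
- by exists ord_max; rewrite // dist_cell1.
Qed.

(** The cells are [D] and its complement. A vertex has 0 or [c] neighbours in [D], according to its
    cell, and the counts in the complement follow because the Hamming graph is regular. *)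
Lemma completely_regular1 : completely_regular D.
Proof.
have D_card0 x : x \in D -> #|[set z in D | hdist x z == 1]| = 0.
  move=> xD; apply/eqP; rewrite cards_eq0; apply/eqP/setP => z; rewrite !inE.
  by apply/negP => /andP[zD]; apply/negP/D_dist.
have cardC x : #|[set z in ~: D | hdist x z == 1]|
    = #|[set z : {ffun 'I_n -> Q} | hdist 0%R z == 1]|
      - #|[set z in D | hdist x z == 1]|.
  rewrite -(card_hdist1 x) -(cardsID D [set z | hdist x z == 1]).
  rewrite (setIdE D) (setIC D) addKn.
  by apply: eq_card => z; rewrite !inE.
have [_ [x _ xD]] := properP D_proper.
have [z zD _] := D_nbr xD.
rewrite /completely_regular distance_partition1; split.
  apply/and3P; split.
  - by rewrite /cover bigcup_setU !big_set1 setUCr.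
  - apply/trivIsetP => A B; rewrite !inE => /orP[]/eqP-> /orP[]/eqP->;
      rewrite ?eqxx // => _; rewrite -setI_eq0 ?setICr // setIC setICr //.
  - rewrite !inE; apply/norP; split.
      by apply/eqP => /setP/(_ z); rewrite inE zD.
    by apply/eqP => /setP/(_ x); rewrite !inE xD.
have cardD s t : (s \in D) = (t \in D) ->
    #|[set z in D | hdist s z == 1]| = #|[set z in D | hdist t z == 1]|.
  have [sD|sD] := boolP (s \in D) => st; first by rewrite !D_card0 -?st.
  by rewrite !D_card -?st.
move=> A B AP BP s t sA tA /=.
have st : (s \in D) = (t \in D).
  move: AP sA tA; rewrite !inE => /orP[]/eqP->; first by move=> -> ->.
  by rewrite !inE => /negbTE-> /negbTE->.
move: BP; rewrite !inE => /orP[]/eqP->; first exact: cardD.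
by rewrite !cardC (cardD s t).
Qed.

End RadiusOne.

(** * Lines of the quotient, blocks of coordinates and factor codes *)

Section HammingQuotient.
Variables (n m : nat) (T : finType) (Q : finZmodType).
Variables (C : {set {ffun 'I_n -> Q}}) (g : {ffun 'I_n -> Q} -> {ffun 'I_m -> T}).
Implicit Types (x y z : {ffun 'I_n -> Q}) (k : 'I_m) (i : 'I_n) (a b : Q).
Local Open Scope ring_scope.
(** The quotient enters only through [g]. In [g_near] the case [a = 0] covers equal cosets. *)
Hypotheses (hadd : additive_code C) (singleC : forall i a, single i a \in C -> a = 0)
  (g_eq : forall x y, (g x == g y) = (x - y \in C))
  (g_near : forall x y,
     (hdist (g x) (g y) <= 1)%N <-> exists i a, x - y - single i a \in C)
  (g_surj : forall u, exists x, g x = u).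

Let C0 : 0 \in C. Proof. by case: hadd. Qed.
Let CB x y : x \in C -> y \in C -> x - y \in C.
Proof. by case: hadd => _; apply. Qed.
Let CN x : x \in C -> - x \in C.
Proof. by move=> xC; rewrite -sub0r CB. Qed.
Let CD x y : x \in C -> y \in C -> x + y \in C.
Proof. by move=> xC yC; rewrite -[y]opprK CB ?CN. Qed.

Let near x := exists i a, x - single i a \in C.

Let nearN x : near x -> near (- x).
Proof.
by case=> i [a xC]; exists i, (- a); rewrite singleN -opprD CN.
Qed.

Let near0 x : near x <-> (hdist (g x) (g 0%R) <= 1)%N.
Proof.
split=> [[i [a xC]]|/g_near]; last by rewrite subr0.
by apply/g_near; exists i, a; rewrite subr0.
Qed.

(** The preimage under [g] of the line through [g 0] in direction [k]: a union of cosets, shown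
    below to be a subgroup. *)
Definition coset_line k x := agree_off k (g x) (g 0).

Lemma coset_line_code k x : x \in C -> coset_line k x.
Proof.
move=> xC; have /eqP gx : g x == g 0 by rewrite g_eq subr0.
by rewrite /coset_line gx agree_off_refl.
Qed.

Lemma coset_line_near k x : coset_line k x -> exists i a, x - single i a \in C.
Proof. by move/hdist_le1/near0. Qed.

(** The pull-back of [agree_off_clique] along [g], applied to [g 0], [g x] and [g y]; the first two
    are distinct because [x] is outside [C]. *)
Lemma coset_line_clique k x y : x \notin C -> coset_line k x ->
  near y -> near (y - x) -> coset_line k y.
Proof.
rewrite -{1}[x]subr0 -g_eq eq_sym /coset_line !(agree_off_sym k _ (g 0)).
move=> x0 kx /near0 y1 /g_near yx.
by apply: agree_off_clique kx x0 _ _; rewrite hdistC.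
Qed.

Lemma coset_lineN k x : coset_line k x -> coset_line k (- x).
Proof.
move=> kx; have [xC|xC] := boolP (x \in C); first by rewrite coset_line_code ?CN.
have nx := coset_line_near kx; apply: coset_line_clique xC kx (nearN nx) _.
(* Modulo [C], [x] is [single i a], so [- x - x] is [single i (- a - a)] and hence near. *)
have [i [a xa]] := nx; exists i, (- a - a).
rewrite singleD singleN.
suff ->: - x - x - (- single i a - single i a)
    = - ((x - single i a) + (x - single i a)).
  by apply/CN/CD.
by rewrite !opprD addrACA.
Qed.

(** For [y] outside [C], the words [0], [- y] and [x - y] have pairwise near images: [x - y] is near
    since [g x] and [g y] share a line, and [x - y - (- y)] is [x]. *)
Lemma coset_lineB k x y : coset_line k x -> coset_line k y -> coset_line k (x - y).
Proof.
move=> kx ky; have [yC|yC] := boolP (y \in C).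
  have /eqP gxy : g (x - y) == g x by rewrite g_eq addrAC subrr sub0r CN.
  by rewrite /coset_line gxy.
have kNy := coset_lineN ky.
have NyC : - y \notin C by apply: contra yC => /CN; rewrite opprK.
apply: coset_line_clique NyC kNy _ _.
  apply/g_near; apply: (@hdist_le1 _ _ k); apply: agree_off_trans kx _.
  by rewrite agree_off_sym.
by rewrite opprK subrK; apply: coset_line_near kx.
Qed.

Lemma coset_lineD k x y : coset_line k x -> coset_line k y -> coset_line k (x + y).
Proof. by move=> kx ky; rewrite -[y]opprK coset_lineB ?coset_lineN. Qed.

Lemma coset_line_inj k k' x :
  x \notin C -> coset_line k x -> coset_line k' x -> k = k'.
Proof. by rewrite -{1}[x]subr0 -g_eq => x0 kx; move/(agree_off_inj kx)/(_ x0). Qed.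

Hypothesis Q_nontrivial : exists a : Q, a != 0.

Lemma single_notin i a : a != 0 -> single i a \notin C.
Proof. by apply: contraNN => /singleC->. Qed.

Lemma single_coset_line :
  exists kk : 'I_n -> 'I_m, forall i a, coset_line (kk i) (single i a).
Proof.
suff /fin_all_exists: forall i, exists k, forall a, coset_line k (single i a) by [].
move=> i.
have [a a0] := Q_nontrivial.
have near_single b : near (single i b) by exists i, b; rewrite subrr.
have aC := single_notin i a0.
(* For [m = 0] there is a single vertex, which would put [single i a] in [C]. *)
have m_gt0 : (0 < m)%N.
  case: (posnP m) => // m0; case/negP: aC; rewrite -[single _ _]subr0 -g_eq.
  by apply/eqP/ffunP => j; have := ltn_ord j; rewrite [X in (_ < X)%N]m0.
have /near0/(hdist_le1_agree m_gt0)[k ka] := near_single a.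
exists k => b; apply: coset_line_clique aC ka (near_single b) _.
by rewrite -singleN -singleD.
Qed.

Variables (kk : 'I_n -> 'I_m).
Hypothesis kkP : forall i a, coset_line (kk i) (single i a).

Lemma single_coset_lineP k i a : a != 0 -> coset_line k (single i a) = (kk i == k).
Proof.
move=> /(single_notin i) aC; apply/idP/eqP => [|<-]; last exact: kkP.
exact: coset_line_inj.
Qed.

Definition block_proj k x : {ffun 'I_n -> Q} :=
  [ffun i => if kk i == k then x i else 0].

Lemma sum_block_proj x : \sum_k block_proj k x = x.
Proof.
apply/ffunP => i; rewrite sum_ffunE; under eq_bigr => k _ do rewrite ffunE eq_sym.
by rewrite -big_mkcond big_pred1_eq.
Qed.

Lemma block_proj_line k x : coset_line k (block_proj k x).
Proof.
rewrite /block_proj -sum_single; apply: (big_ind (coset_line k)).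
- exact: coset_line_code.
- exact: coset_lineD.
- by move=> i /eqP <-.
Qed.

Lemma block_projB k x y : block_proj k (x - y) = block_proj k x - block_proj k y.
Proof. by apply/ffunP => i; rewrite !ffunE; case: ifP; rewrite ?subr0. Qed.

Lemma sum_code (F : 'I_m -> {ffun 'I_n -> Q}) :
  (forall k, F k \in C) -> \sum_k F k \in C.
Proof. by move=> FC; apply: (big_ind (fun x => x \in C)) => // x y; apply: CD. Qed.

(* The g-values of the block projections determine g, which is onto, so by    *)
(* counting they are in turn determined by g.                                 *)
Lemma block_projP x : (x \in C) = [forall k, block_proj k x \in C].
Proof.
pose h x : {ffun 'I_m -> T} := [ffun k => g (block_proj k x) k].
(* On a line in direction [k], coordinate [k] determines the vertex; so equal [h] puts every block
   of [y - z] in [C], hence also their sum. *)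
have h_g y z : h y = h z -> g y = g z.
  move=> /ffunP hyz; apply/eqP; rewrite g_eq -[y - z]sum_block_proj.
  apply: sum_code => k; rewrite block_projB -g_eq; apply/eqP.
  apply: (@agree_off_eq _ _ k); last by have := hyz k; rewrite !ffunE.
  apply: (agree_off_trans (block_proj_line k y)).
  by rewrite agree_off_sym; apply: block_proj_line.
have [r rK] := fin_all_exists g_surj.
(* An injective self-map of a finite set is onto, so each [h y] is [h (r u)] for some [u]; [h_g]
   then forces [u = g y]. *)
have /injF_bij[t _ tK] : injective (h \o r).
  by move=> u v /h_g; rewrite !rK.
have hE y : h y = h (r (g y)).
  have hy := tK (h y); rewrite /= in hy.
  by rewrite -[LHS]hy; congr (h (r _)); rewrite -[LHS]rK; apply: h_g.
apply/idP/forallP => [xC k|]; last by move/sum_code; rewrite sum_block_proj.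
have /eqP gx : g x == g 0 by rewrite g_eq subr0.
have: block_proj k 0 = 0 by apply/ffunP => i; rewrite !ffunE if_same.
rewrite -[block_proj k x]subr0 => <-; rewrite -g_eq; apply/eqP.
apply: (@agree_off_eq _ _ k).
  apply: (agree_off_trans (block_proj_line k x)).
  by rewrite agree_off_sym; apply: block_proj_line.
by have := hE x; rewrite gx -hE => /ffunP/(_ k); rewrite !ffunE.
Qed.

Variable c : nat.
Hypothesis C_nbrs : forall x i a, x \notin C -> x - single i a \in C ->
  #|[set z in C | hdist x z == 1%N]| = c.

Lemma card_line_minus1 k (v : {ffun 'I_m -> T}) :
  #|[set u | agree_off k u v && (u != v)]| = #|T|.-1.
Proof.
rewrite -(cardsC1 (v k)).
rewrite -(card_in_imset (f := fun t => [ffun j => if j == k then t else v j])).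
  apply: eq_card => u; rewrite inE; apply/andP/imsetP.
    case=> uv neq_uv; exists (u k).
      by rewrite !inE; apply: contraNneq neq_uv => /(agree_off_eq uv)->.
    apply: (@agree_off_eq _ _ k); last by rewrite !ffunE eqxx.
    apply/agree_offP => j /[dup] jk /(agree_offP _ _ _ uv) ->.
    by rewrite ffunE (negbTE jk).
  case=> t; rewrite !inE => tv ->; split.
    by apply/agree_offP => j /negbTE jk; rewrite ffunE jk.
  by apply: contraNneq tv => /ffunP/(_ k); rewrite ffunE eqxx => ->.
by move=> s t _ _ /ffunP/(_ k); rewrite !ffunE eqxx.
Qed.

(* Each coset in a line through C, other than C, has c words of weight one.   *)
Lemma card_block k : (#|[set i | kk i == k]| * #|Q|.-1 = c * #|T|.-1)%N.
Proof.
pose L := [set u | agree_off k u (g 0) && (u != g 0)].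
rewrite -(cardsC1 (0 : Q)) -cardsX -(card_line_minus1 k (g 0)) mulnC -/L.
(* The pairs [(i, a)] with [i] in block [k] and [a] nonzero are sorted by the vertex
   [g (single i a)] of the line. *)
rewrite -sum1_card (partition_big (fun p => g (single p.1 p.2)) (mem L)) /=.
  rewrite -sum_nat_const; apply: eq_bigr => u; rewrite inE => /andP[ku u0].
  have [x gx] := g_surj u; rewrite -{}gx in ku u0 *.
  have xC : x \notin C by move: u0; rewrite g_eq subr0.
  have [i [a xa]] := coset_line_near ku.
  rewrite -(C_nbrs xC xa) sum1dep_card.
  (* This map carries the fibre over [g x] bijectively onto the neighbours of [x] in [C]. *)
  rewrite -(card_in_imset (f := fun p => x - single p.1 p.2)).
    apply: eq_card => z; apply/imsetP/idP => [[[j b]]|].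
      rewrite !inE /= g_eq => /andP[/andP[_ b0] bx] ->; apply/andP; split.
        by rewrite -opprB CN.
      by apply/hdist1P; exists j, b; rewrite opprB addrC subrK.
    rewrite inE => /andP[zC /hdist1P[j [b [b0 xz]]]].
    exists (j, b); last by rewrite /= -xz opprB addrC subrK.
    have bx : single j b - x \in C by rewrite -xz addrAC subrr sub0r CN.
    rewrite !inE /= g_eq b0 bx !andbT -(single_coset_lineP _ _ b0).
    by rewrite -[single j b](subrK x); apply: coset_lineD ku; apply: coset_line_code.
  move=> [j b] [j' b']; rewrite !inE /= => /andP[/andP[_ b0] _] _.
  by move=> /addrI/oppr_inj/(single_inj b0)[-> ->].
move=> [i a]; rewrite !inE /= => /andP[/eqP<- a0]; rewrite -/(coset_line _ _) kkP /=.
by rewrite g_eq subr0 single_notin.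
Qed.

Variables (l : nat) (r : 'I_n -> 'I_l).
Hypothesis r_surj : forall k (j : 'I_l), exists2 i, kk i = k & r i = j.
Hypothesis r_inj : forall i i', kk i = kk i' -> r i = r i' -> i = i'.

Definition block_embed k (y : {ffun 'I_l -> Q}) : {ffun 'I_n -> Q} :=
  [ffun i => if kk i == k then y (r i) else 0].

(** The shortening of [C] to block [k]; by [block_projP] it is also the projection of [C] onto that
    block. *)
Definition block_code k : {set {ffun 'I_l -> Q}} :=
  [set y | block_embed k y \in C].

Lemma block_embedB k (y z : {ffun 'I_l -> Q}) :
  block_embed k (y - z) = block_embed k y - block_embed k z.
Proof. by apply/ffunP => i; rewrite !ffunE; case: ifP; rewrite ?subr0. Qed.

Lemma block_embed_inj k : injective (block_embed k).
Proof.
move=> y z /ffunP yz; apply/ffunP => j; have [i ik <-] := r_surj k j.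
by have := yz i; rewrite !ffunE ik eqxx.
Qed.

Lemma block_embed_single i a :
  block_embed (kk i) (single (r i) a) = single i a.
Proof.
apply/ffunP => i'; rewrite !ffunE.
have [->|ii'] := eqVneq i' i; first by rewrite !eqxx.
case: eqP => // ki; case: eqP => // ri.
by rewrite (r_inj ki ri) eqxx in ii'.
Qed.

Lemma block_embed_line k (y : {ffun 'I_l -> Q}) : coset_line k (block_embed k y).
Proof.
suff <-: block_proj k (block_embed k y) = block_embed k y by apply: block_proj_line.
by apply/ffunP => i; rewrite !ffunE; case: eqP.
Qed.

(** Modulo [C], [single i a] equals a word of block [k], so it lies in [coset_line k] and [i]
    belongs to block [k]: passing to a neighbour in [C] never leaves the block. *)
Lemma block_nbr k (y : {ffun 'I_l -> Q}) i a : a != 0 ->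
  block_embed k y - single i a \in C ->
  block_embed k y - single i a = block_embed k (y - single (r i) a).
Proof.
move=> a0 /(coset_line_code k)/coset_lineN; rewrite opprB.
move=> /coset_lineD/(_ (block_embed_line k y)); rewrite subrK.
rewrite single_coset_lineP // => /eqP ik.
by rewrite block_embedB -ik block_embed_single.
Qed.

(** By [block_nbr], the neighbours in [C] of an embedded word are the embedded neighbours in the
    factor, so the constant [c] carries over. *)
Lemma block_code_regular k : (0 < l)%N ->
  completely_regular (block_code k) /\ covering_radius (block_code k) = 1%N.
Proof.
move=> l_gt0.
have D_proper : block_code k \proper setT.
  rewrite properE subsetT; apply/subsetPn.
  have [i ik _] := r_surj k (Ordinal l_gt0); have [a a0] := Q_nontrivial.
  exists (single (r i) a); first by rewrite inE.
  by rewrite inE -ik block_embed_single single_notin.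
have D_dist : {in block_code k &, forall y z : {ffun 'I_l -> Q}, hdist y z != 1%N}.
  move=> y z; rewrite !inE => yC zC; apply/hdist1P => -[j [a [a0 yz]]].
  have := CB yC zC; rewrite -block_embedB yz; have [i <- <-] := r_surj k j.
  by rewrite block_embed_single; apply/negP/single_notin.
have hdist_nbr (y : {ffun 'I_l -> Q}) i a :
    a != 0 -> hdist y (y - single (r i) a) == 1%N.
  by move=> a0; apply/hdist1P; exists (r i), a; rewrite opprB addrC subrK.
have D_nbr (y : {ffun 'I_l -> Q}) : y \notin block_code k ->
    exists2 z, z \in block_code k & hdist y z = 1%N.
  rewrite inE => yC; have [i [a ya]] := coset_line_near (block_embed_line k y).
  have a0 : a != 0 by apply: contraNneq yC => a0; rewrite a0 single0 subr0 in ya.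
  exists (y - single (r i) a); last exact/eqP/hdist_nbr.
  by rewrite inE -block_nbr.
have D_card (y : {ffun 'I_l -> Q}) : y \notin block_code k ->
    #|[set z in block_code k | hdist y z == 1%N]| = c.
  rewrite inE => yC; have [i [a ya]] := coset_line_near (block_embed_line k y).
  rewrite -(C_nbrs yC ya) -(card_imset _ (@block_embed_inj k)); apply: eq_card => x.
  rewrite inE; apply/imsetP/andP.
    case=> z; rewrite !inE => /andP[zC /hdist1P[j [b [b0 yz]]]] ->; split=> //.
    have [i' i'k ri'] := r_surj k j; apply/hdist1P; exists i', b; split=> //.
    by rewrite -block_embedB yz -ri' -i'k block_embed_single.
  case=> xC /hdist1P[i' [b [b0 yx]]].
  have xE : x = block_embed k y - single i' b by rewrite -yx opprB addrC subrK.
  rewrite xE in xC *; exists (y - single (r i') b); last exact: block_nbr.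
  by rewrite !inE hdist_nbr // -block_nbr ?xC.
split; first exact: completely_regular1 D_card.
exact: covering_radius1.
Qed.

End HammingQuotient.

(** * Numbering coordinates by block and rank *)

Lemma divisible_blocks n m l (kk : 'I_n -> 'I_m) :
  (forall k, #|[set i | kk i == k]| = l) -> n = m * l.
Proof.
move=> cl; rewrite -[LHS]card_ord -sum1_card (partition_big kk predT) //=.
rewrite -[m in RHS]card_ord -sum_nat_const; apply: eq_bigr => k _.
by rewrite sum1dep_card cl.
Qed.

(** The rank of [i] is its position in the enumeration of its own block. *)
Lemma block_rank n m l (kk : 'I_n -> 'I_m) :
  (forall k, #|[set i | kk i == k]| = l) ->
  exists r : 'I_n -> 'I_l,
    (forall k j, exists2 i, kk i = k & r i = j) /\
    (forall i i', kk i = kk i' -> r i = r i' -> i = i').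
Proof.
move=> cl; pose B k := [set i | kk i == k].
have iB i : i \in B (kk i) by rewrite inE.
exists (fun i => cast_ord (cl (kk i)) (enum_rank_in (iB i) i)); split.
  move=> k j; pose i := enum_val (cast_ord (esym (cl k)) j).
  have /[!inE]/eqP ik : i \in B k by apply: enum_valP.
  exists i => //; apply/val_inj => /=.
  by move: (iB i); rewrite ik => ?; rewrite enum_valK_in.
move=> i i' ii' /(congr1 val) /=; move: (iB i) (iB i'); rewrite ii' => h h' rr.
by move/ord_inj/(congr1 enum_val): rr; rewrite !enum_rankK_in.
Qed.

Lemma block_index_inj m l (k k' : 'I_m) (j j' : 'I_l) :
  block_index k j = block_index k' j' -> k = k' /\ j = j'.
Proof.
move=> /(congr1 val) /= e; have l_gt0 : 0 < l by apply: leq_ltn_trans (ltn_ord j).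
have ek : val k = val k'.
  by have := congr1 (divn^~ l) e; rewrite !divnMDl // !divn_small // !addn0.
split; apply: val_inj => //; move/eqP: e.
by rewrite -[k : nat]/(val k) ek eqn_add2l => /eqP.
Qed.

(** * From the graph isomorphism to the product decomposition *)

Theorem theorem3p11 (Q : finZmodType) (q n m q' : nat)
    (C : {set {ffun 'I_n -> Q}})
    (hQ : #|Q| = q) (hq : 1 < q) (hn : 0 < n)
    (hadd : additive_code C)
    (hreg : completely_regular C)
    (hdelta : 2 <= min_distance C)
    (hquot : graph_iso (coset_partition C) (quotient_adj (@hamming_adj n Q))
               [set: {ffun 'I_m -> 'I_q'}] (@hamming_adj m 'I_q')) :
  m %| n /\
  exists D : 'I_m -> {set {ffun 'I_(n %/ m) -> Q}},
    equal_up_to_coords C (prod_code D) /\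
    forall i : 'I_m, completely_regular (D i) /\ covering_radius (D i) = 1.
Proof.
have [C0 CB] := hadd.
have CN x : x \in C -> (- x \in C)%R by move=> xC; rewrite -sub0r CB.
have CD x y : x \in C -> y \in C -> (x + y \in C)%R.
  by move=> xC yC; rewrite -[y]opprK CB ?CN.
have Q_nontrivial : exists a : Q, a != 0%R.
  have /card_gt0P[a] : 0 < #|[set~ (0 : Q)%R]|.
    by rewrite cardsC1 hQ -ltnS prednK // ltnW.
  by rewrite !inE; exists a.
(* A nonzero [single i a] is at distance 1 from the codeword 0, against [hdelta]. *)
have singleC i a : single i a \in C -> a = 0%R.
  move=> aC; apply/eqP/negPn/negP => a0.
  have /eqP a1 : hdist (single i a) 0%R == 1.
    by apply/hdist1P; exists i, a; rewrite subr0.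
  have a_neq0 : single i a != 0%R by rewrite -hdist_eq0 a1.
  by have := leq_trans hdelta (min_distance_le aC C0 a_neq0); rewrite a1.
have [f [f_inj f_surj f_adj]] := hquot.
pose coset (x : {ffun 'I_n -> Q}) := [set (c + x)%R | c : {ffun 'I_n -> Q} in C].
have coset_in x : coset x \in coset_partition C by apply/imsetP; exists x.
have cosetP x y : reflect (y - x \in C)%R (y \in coset x).
  apply: (iffP imsetP) => [[c cC ->]|xy]; first by rewrite addrK.
  by exists (y - x)%R; rewrite ?subrK.
have coset_eq x y : (coset x == coset y) = (x - y \in C)%R.
  apply/eqP/idP => [xy|xy]; last first.
    apply/setP => z; apply/cosetP/cosetP => zC.
      by rewrite -(subrKA x) CD.
    by rewrite -(subrKA y) CD // -opprB CN.
  by apply/cosetP; rewrite -xy; apply/cosetP; rewrite subrr.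
pose g x := f (coset x).
have g_eq x y : (g x == g y) = (x - y \in C)%R.
  by rewrite -coset_eq; apply/eqP/eqP => [/f_inj->|xy] //; rewrite /g xy.
pose i0 := Ordinal hn.
have g_near x y : hdist (g x) (g y) <= 1 <->
    exists i a, (x - y - single i a \in C)%R.
  split=> [|[i [a xya]]].
    rewrite leq_eqVlt ltnS leqn0 hdist_eq0 => /orP[g1|]; last first.
      by rewrite g_eq => xy; exists i0, 0%R; rewrite single0 subr0.
    have : quotient_adj (@hamming_adj n Q) (coset x) (coset y) by rewrite f_adj.
    case/andP => _ /exists_inP[x' /cosetP xx' /exists_inP[y' /cosetP yy']].
    case/hdist1P => i [a [_ xya]]; exists i, a; rewrite -xya.
    (* The edge joins representatives [x'] and [y']; replacing them by [x] and [y] costs two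
       codewords. *)
    suff ->: (x - y - (x' - y') = (y' - y) - (x' - x))%R by apply: CB.
    by rewrite !opprB addrACA [RHS]addrACA (addrC y' x).
  have [xy|xy] := boolP (x - y \in C)%R.
    by move: xy; rewrite -g_eq -hdist_eq0 => /eqP->.
  have a0 : a != 0%R.
    by apply: contraNneq xy => a0; move: xya; rewrite a0 single0 subr0.
  suff : hamming_adj (g x) (g y) by move/eqP->.
  rewrite -f_adj //; apply/andP; split; first by rewrite coset_eq.
  apply/exists_inP; exists x; first by apply/cosetP; rewrite subrr.
  apply/exists_inP; exists (x - single i a)%R; first by apply/cosetP; rewrite addrAC.
  by apply/hdist1P; exists i, a; rewrite opprB addrC subrK.
have g_surj u : exists x, g x = u.
  have : u \in f @: coset_partition C by rewrite f_surj inE.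
  by case/imsetP => _ /imsetP[x _ ->] ->; exists x.
have [kk kkP] := single_coset_line hadd singleC g_eq g_near Q_nontrivial.
(* The constant [c] is the number of neighbours in cell 0 of a vertex of cell 1, read off at
   [single i0 a]. *)
have [c C_nbrs] : exists c, forall x i a, x \notin C -> (x - single i a \in C)%R ->
    #|[set z in C | hdist x z == 1]| = c.
  have cell1 x i a : x \notin C -> (x - single i a \in C)%R -> x \in dist_cell C 1.
    move=> xC xa; rewrite inE; apply/andP; split.
      apply/exists_inP; exists (x - single i a)%R => //.
      apply/hdist1P; exists i, a; split; last by rewrite opprB addrC subrK.
      by apply: contraNneq xC => a0; rewrite a0 single0 subr0 in xa.
    by apply/forall_inP => z zC; rewrite lt0n hdist_eq0; apply: contraNneq xC => ->.
  have [a a0] := Q_nontrivial.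
  pose x0 := single i0 a; exists #|[set z in C | hdist x0 z == 1]| => x i b xC xb.
  have x0C : x0 \notin C by apply: contraNN a0 => /singleC->.
  have x0_cell : x0 \in dist_cell C 1 by apply: (cell1 _ i0 a); rewrite ?subrr.
  have [_ reg] := hreg; apply: (reg (dist_cell C 1)) => //; last exact: cell1 xb.
    by apply: dist_cell_in_partition; apply/set0Pn; exists x0.
  rewrite -{1}(dist_cell0 C) dist_cell_in_partition // dist_cell0.
  by apply/set0Pn; exists 0%R.
have q1 : 0 < #|Q|.-1 by rewrite hQ -ltnS prednK // ltnW.
(* By [card_block] the product of a block size with [#|Q|.-1] does not depend on the block; the
   positive factor cancels. *)
have card_kk k : #|[set i | kk i == k]| = #|[set i | kk i == kk i0]|.
  apply/eqP; rewrite -(eqn_pmul2r q1).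
  by rewrite !(card_block hadd singleC g_eq g_near g_surj kkP C_nbrs).
have nE := divisible_blocks card_kk.
have m_gt0 : 0 < m by apply: leq_ltn_trans (ltn_ord (kk i0)).
have m_dvd : m %| n by rewrite nE dvdn_mulr.
split=> //; have l_gt0 : 0 < n %/ m by rewrite divn_gt0 // dvdn_leq.
have card_l k : #|[set i | kk i == k]| = n %/ m by rewrite card_kk [in RHS]nE mulKn.
have [r [r_surj r_inj]] := block_rank card_l.
exists (block_code C kk r); split; last first.
  move=> k.
  exact: (block_code_regular hadd singleC g_eq g_near Q_nontrivial kkP C_nbrs
    r_surj r_inj).
pose s i := block_index (kk i) (r i).
have s_bij : bijective s.
  apply: inj_card_bij; last by rewrite !card_ord mulnC divnK.
  by move=> i j /block_index_inj[]; apply: r_inj.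
exists s => //.
(* Embedding the [k]-th part of [y] gives [block_proj k] of the permuted word, so [block_projP]
   applies. *)
have prod_codeE y :
    (y \in prod_code (block_code C kk r)) = ([ffun i => y (s i)] \in C).
  rewrite inE (block_projP hadd g_eq g_near g_surj kkP).
  apply: eq_forallb => k; rewrite inE; congr (_ \in C); apply/ffunP => i.
  by rewrite !ffunE; case: eqP => // <-.
have [t sK tK] := s_bij; apply/setP => x; apply/idP/imsetP => [xC|[y yD ->]].
  exists [ffun j => x (t j)]; last by apply/ffunP => i; rewrite !ffunE sK.
  by rewrite prod_codeE; congr (_ \in C): xC; apply/ffunP => i; rewrite !ffunE sK.
by rewrite -prod_codeE.
Qed.
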